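(* Let $n\ge 2$ and let $p$ be a non-constant holomorphic polynomial on $\mathbb{C}^n$ such that $p(z_1,\dots,z_{n-1},z_n)=p(z_1,\dots,z_{n-1},0)$ for all $z\in\mathbb{C}^n$. Let $f(z)=K_{-2\pi \mathrm{i}I_n}(z)=e^{2\pi\mathrm{i}z_n}$ and $g(z)=K_{I_n}(z)=e^{z_n}$, where $I_n=(0,\dots,0,1)\in\mathbb{C}^n$. Then $$T_{pf}T_{\overline{g}}=T_{pf\overline{g}}.$$
   Context: $dV$ is Lebesgue measure on $\mathbb{C}^n$ and $d\mu(z)=\pi^{-n}e^{-|z|^2}dV(z)$. For $z,w\in\mathbb{C}^n$, $z\cdot w=\sum_k z_kw_k$ (bilinear) and $|z|^2=z\cdot\overline{z}$. $F^2$ is the Fock space of entire functions in $L^2(\mathbb{C}^n,d\mu)$, with reproducing kernel $K_z(w)=e^{w\cdot\overline{z}}$. Toeplitz operators: $T_\varphi=PM_\varphi$, where $M_\varphi$ is multiplication by $\varphi$ and $P$ is the orthogonal projection of $L^2(\mathbb{C}^n,d\mu)$ onto $F^2$; explicitly $T_\varphi F(z)=\int_{\mathbb{C}^n}\varphi(w)F(w)e^{z\cdot\overline{w}}\,d\mu(w)$. Such operators may be unbounded; identities between Toeplitz operators and their products are understood as identities on the (dense) linear span of the kernels $K_z$, $z\in\mathbb{C}^n$, where all the integrals involved converge. *)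

(* Defs.v *)
(* [mpoly] is required without being imported: its notations clash with those of
   MathComp-Analysis. *)
From HB Require Import structures.
From mathcomp Require Import all_boot all_order all_algebra.
From mathcomp Require Import all_classical all_reals all_analysis.
From mathcomp Require Export complex.
From mathcomp Require mpoly.

Set Implicit Arguments.
Unset Strict Implicit.
Unset Printing Implicit Defensive.

Import Order.TTheory GRing.Theory Num.Theory.

Local Open Scope classical_set_scope.
Local Open Scope complex_scope.
Local Open Scope ring_scope.

Lemma product_sigma_finite d1 d2 (T1 : measurableType d1)
    (T2 : measurableType d2) (R : realType)
    (m1 : {sigma_finite_measure set T1 -> \bar R})
    (m2 : {sigma_finite_measure set T2 -> \bar R}) :
  sigma_finite [set: T1 * T2] (m1 \x m2)%E.
Proof.
have /sigma_finiteP[F [TF ndF Foo]] := sigma_finiteT m1.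
have /sigma_finiteP[G [TG ndG Goo]] := sigma_finiteT m2.
exists (fun n => F n `*` G n).
  rewrite -setXTT TF TG predeqE => -[x y]; split.
    move=> [/= [n _ Fnx] [k _ Gky]]; exists (maxn n k) => //; split.
    - by move: x Fnx; exact/subsetPset/ndF/leq_maxl.
    - by move: y Gky; exact/subsetPset/ndG/leq_maxr.
  by move=> [n _ []/= ? ?]; split; exists n.
move=> k; have [? ?] := Foo k; have [? ?] := Goo k.
split; first exact: measurableX.
by rewrite product_measure1E// lte_mul_pinfty// ge0_fin_numE.
Qed.

(* C is integrated over as the real plane. *)
Notation plane R := (measurableTypeR R * measurableTypeR R)%type.

Definition lebesgue_plane (R : realType) : set (plane R) -> \bar R :=
  (@lebesgue_measure R \x @lebesgue_measure R)%E.
HB.instance Definition _ (R : realType) := Measure.on (@lebesgue_plane R).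
HB.instance Definition _ (R : realType) :=
  Measure_isSigmaFinite.Build _ _ _ (@lebesgue_plane R)
    (product_sigma_finite (@lebesgue_measure R) (@lebesgue_measure R)).

Section LebesgueStep.
Variables (R : realType) (n : nat).

Definition cons_plane (x : plane R * n.-tuple (plane R)) :
  n.+1.-tuple (plane R) := [tuple of x.1 :: x.2].

Lemma measurable_cons_plane : measurable_fun [set: _] cons_plane.
Proof. exact: measurable_cons. Qed.

Variable mu : {sigma_finite_measure set (n.-tuple (plane R)) -> \bar R}.

Definition lebesgue_cons : set (n.+1.-tuple (plane R)) -> \bar R :=
  pushforward (@lebesgue_plane R \x mu)%E cons_plane.

Let M : {measure set _ -> \bar R} :=
  measure_function_pushforward__canonical__measure_function_Measure
    (@lebesgue_plane R \x mu)%E measurable_cons_plane.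

HB.instance Definition _ := isMeasure.Build _ _ _ lebesgue_cons
  (measure0 M) (measure_ge0 M) (@measure_semi_sigma_additive _ _ _ M).

Let lebesgue_cons_sigma_finite : sigma_finite [set: _] lebesgue_cons.
Proof.
have [F TF Foo] := product_sigma_finite (@lebesgue_plane R) mu.
pose u (t : n.+1.-tuple (plane R)) := (thead t, [tuple of behead t]).
have mu_ : measurable_fun [set: _] u.
  apply/measurable_fun_pairP; split; last exact: measurable_behead.
  exact: measurable_tnth.
exists (fun k => u @^-1` F k).
  by rewrite -preimage_bigcup -TF preimage_setT.
move=> k; have [mF Fk] := Foo k; split.
  by rewrite -[X in measurable X]setTI; exact: mu_.
rewrite /lebesgue_cons /pushforward -comp_preimage.
rewrite (_ : u \o cons_plane = id)//.
apply/funext => -[x t] /=; rewrite /u theadE.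
by congr pair; apply/val_inj.
Qed.

HB.instance Definition _ := Measure_isSigmaFinite.Build _ _ _ lebesgue_cons
  lebesgue_cons_sigma_finite.

End LebesgueStep.

(* Lebesgue measure dV on C^n, with C^n seen as n-tuples of real planes, as an
   iterated product of one-dimensional Lebesgue measures. *)
Fixpoint lebesgue_Cn (R : realType) (n : nat) :
    {sigma_finite_measure set (n.-tuple (plane R)) -> \bar R} :=
  match n with
  | 0 => @dirac _ (0.-tuple (plane R)) [tuple] R
  | k.+1 => lebesgue_cons (lebesgue_Cn R k)
  end.

Lemma lebesgue_Cn_box (R : realType) (n : nat)
    (A B : 'I_n -> set (measurableTypeR R)) :
  (forall k, measurable (A k)) -> (forall k, measurable (B k)) ->
  lebesgue_Cn R n [set t | forall k, A k (tnth t k).1 /\ B k (tnth t k).2] =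
  (\prod_(k < n) (lebesgue_measure (A k) * lebesgue_measure (B k)))%E.
Proof.
have mbox m (A' B' : 'I_m -> set (measurableTypeR R)) :
    (forall k, measurable (A' k)) -> (forall k, measurable (B' k)) ->
    measurable [set t : m.-tuple (plane R) |
                forall k, A' k (tnth t k).1 /\ B' k (tnth t k).2].
  move=> mA mB; rewrite (_ : [set _ | _] =
      \bigcap_(k in [set: 'I_m]) ((@tnth _ _)^~ k @^-1` (A' k `*` B' k))).
    apply: fin_bigcap_measurable => // k _; rewrite -[X in measurable X]setTI.
    by apply: measurable_tnth => //; exact: measurableX.
  by apply/seteqP; split=> [t h k _|t h k]; [exact: h|exact: (h k I)].
elim: n A B => [|n IHn] A B mA mB /=.
  rewrite big_ord0 /dirac indicE mem_set// => -[].
  by move=> m h; have := h; rewrite ltn0.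
rewrite big_ord_recl /= /lebesgue_cons /pushforward.
rewrite (_ : _ @^-1` _ = (A ord0 `*` B ord0) `*` [set t | forall k : 'I_n,
    A (lift ord0 k) (tnth t k).1 /\ B (lift ord0 k) (tnth t k).2]); last first.
  apply/seteqP; split=> [[x t] /= h|[x t] /= [h0 h] k].
    split; first by have := h ord0; rewrite tnth0.
    by move=> k; have := h (lift ord0 k); rewrite tnthS.
  have [j ->|->] := unliftP ord0 k; last by rewrite tnth0.
  by rewrite tnthS; exact: h.
rewrite product_measure1E//; last 2 first.
- exact: measurableX.
- exact: (mbox n (fun k => A (lift ord0 k)) (fun k => B (lift ord0 k))).
rewrite (IHn (fun k => A (lift ord0 k)) (fun k => B (lift ord0 k)))//=.
by rewrite /lebesgue_plane product_measure1E.
Qed.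

Section Fock.
Variables (R : realType) (n : nat).
Notation C := R[i].
Notation Cn := 'rV[C]_n.

Definition cexp (z : C) : C :=
  (expR (complex.Re z))%:C * (cos (complex.Im z) +i* sin (complex.Im z)).

Definition cdot (z w : Cn) : C := \sum_(k < n) z 0 k * w 0 k.

Definition conjv (z : Cn) : Cn := \row_k (z 0 k)^*%C.

Definition to_Cn (t : n.-tuple (plane R)) : Cn :=
  \row_k ((tnth t k).1 +i* (tnth t k).2).

(* pi^-n e^(-|z|^2), the density of dmu with respect to dV, with
   |z|^2 = z . conj z (a real number, here as an element of C). *)
Definition gauss_density (z : Cn) : C :=
  (pi ^- n)%:C * cexp (- cdot z (conjv z)).

Definition cintegrable_dV (h : Cn -> C) : Prop :=
  (lebesgue_Cn R n).-integrable [set: _]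
    (fun t => (complex.Re (h (to_Cn t)))%:E) /\
  (lebesgue_Cn R n).-integrable [set: _]
    (fun t => (complex.Im (h (to_Cn t)))%:E).

Definition cintegral_dV (h : Cn -> C) : C :=
  (Rintegral (lebesgue_Cn R n) [set: _]
     (fun t => complex.Re (h (to_Cn t)))) +i*
  (Rintegral (lebesgue_Cn R n) [set: _]
     (fun t => complex.Im (h (to_Cn t)))).

Definition integrable_dmu (h : Cn -> C) : Prop :=
  cintegrable_dV (fun w => h w * gauss_density w).

Definition integral_dmu (h : Cn -> C) : C :=
  cintegral_dV (fun w => h w * gauss_density w).

Definition fock_kernel (z w : Cn) : C := cexp (cdot w (conjv z)).

Definition toeplitz (phi F : Cn -> C) (z : Cn) : C :=
  integral_dmu (fun w => phi w * F w * cexp (cdot z (conjv w))).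

(* [toeplitz] takes a junk value where its integral diverges, so that
   identities between Toeplitz operators are to be read on such [F]. *)
Definition toeplitz_converges (phi F : Cn -> C) : Prop :=
  forall z, integrable_dmu (fun w => phi w * F w * cexp (cdot z (conjv w))).

Definition kernel_span (F : Cn -> C) : Prop :=
  exists s : seq (C * Cn),
    forall z, F z = \sum_(c <- s) c.1 * fock_kernel c.2 z.

(* I_n = (0, ..., 0, 1); the last coordinate is the k with k.+1 = n. *)
Definition last_unit : Cn := \row_k (k.+1 == n)%:R.

Definition zero_last (z : Cn) : Cn :=
  \row_k (if k.+1 == n then 0 else z 0 k).

Definition poly_fun (p : mpoly.mpoly n C) (z : Cn) : C :=
  mpoly.meval (fun k => z 0 k) p.

End Fock.

Lemma fock_kernel_last (R : realType) (n : nat) (a : R[i]) (z : 'rV[R[i]]_n)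
    (k : 'I_n) :
  k.+1 = n ->
  fock_kernel (a *: last_unit R n) z = cexp (a^*%C * z 0 k).
Proof.
move=> kn; congr cexp; rewrite /cdot (bigD1 k)//= big1 => [|j jk].
  by rewrite !mxE kn eqxx mulr1 addr0 mulrC.
rewrite !mxE (_ : (j.+1 == n) = false) ?mulr0 ?rmorph0 ?mulr0//.
by apply: contraNF jk => /eqP jn; apply/eqP/val_inj/succn_inj; rewrite jn kn.
Qed.

Lemma fock_kernel_2pi_last (R : realType) (n : nat) (z : 'rV[R[i]]_n)
    (k : 'I_n) :
  k.+1 = n ->
  fock_kernel ((- ((2 * pi)%:C * 'i%C)) *: last_unit R n) z =
  cexp ((2 * pi)%:C * 'i%C * z 0 k).
Proof.
move=> kn; move: (2 * pi) => c; rewrite (fock_kernel_last _ _ kn).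
suff -> : (- (c%:C * 'i%C))^*%C = c%:C * 'i%C :> R[i] by [].
apply/eqP; rewrite eq_complex /= !(mul0r, mulr0, mulr1).
by rewrite subr0 addr0 oppr0 opprK !eqxx.
Qed.

(* Main.v *)
(* Everything follows from the Gaussian moment formula: for b, c in C^n and every
   holomorphic polynomial p, the integral of p(w) exp(w . b + c . conj w) dmu(w)
   is p(c) exp(c . b). Applied to the kernels, it gives
   T_(conj g) K_a = exp(conj a_n) K_a and T_(pf) K_a = p f K_a, and it shows that
   T_(p f conj g) K_a is the translate of p f K_a by I_n; this translate is
   exp(conj a_n) p f K_a since p does not depend on z_n and exp(2 pi i) = 1.

   By Fubini the moment formula reduces to one complex variable. There, the
   integral without polynomial factor splits into two one-dimensional integrals
   of exp(s x - x^2), s complex; with s replaced by t s, such an integral solves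
   a linear differential equation in the real variable t, through an integration
   by parts. A power w^m is then produced by differentiating m times with respect
   to b. *)
Require Import Defs.
From HB Require Import structures.
From mathcomp Require Import all_boot all_order all_algebra.
From mathcomp Require Import all_classical all_reals all_analysis.
From mathcomp Require Import complex measurable_realfun ring lra.
From mathcomp Require mpoly.

Set Implicit Arguments.
Unset Strict Implicit.
Unset Printing Implicit Defensive.

Import Order.TTheory GRing.Theory Num.Theory.
Import numFieldNormedType.Exports ComplexField.Normc.

Local Open Scope classical_set_scope.
Local Open Scope complex_scope.
Local Open Scope ring_scope.

(** * Complex exponential and complex-valued functions of a real variable *)

Section ComplexExponential.
Variable R : realType.
Implicit Types (x y z w : R[i]) (r t : R).

Local Notation Re := (@complex.Re R).
Local Notation Im := (@complex.Im R).

Lemma Re_add z w : Re (z + w) = Re z + Re w.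
Proof. by case: z; case: w. Qed.

Lemma Im_add z w : Im (z + w) = Im z + Im w.
Proof. by case: z; case: w. Qed.

Lemma Re_opp z : Re (- z) = - Re z.
Proof. by case: z. Qed.

Lemma Re_mul z w : Re (z * w) = Re z * Re w - Im z * Im w.
Proof. by case: z; case: w. Qed.

Lemma Im_mul z w : Im (z * w) = Re z * Im w + Im z * Re w.
Proof. by case: z => a b; case: w. Qed.

Lemma complex_eqP z w : Re z = Re w -> Im z = Im w -> z = w.
Proof. by case: z; case: w => a b c d /= -> ->. Qed.

Lemma Re_cexp z : Re (cexp z) = expR (Re z) * cos (Im z).
Proof. by rewrite /cexp Re_mul /= mul0r subr0. Qed.

Lemma Im_cexp z : Im (cexp z) = expR (Re z) * sin (Im z).
Proof. by rewrite /cexp Im_mul /= mul0r addr0. Qed.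

Lemma cexpD z w : cexp (z + w) = cexp z * cexp w.
Proof.
apply: complex_eqP; rewrite ?Re_cexp ?Im_cexp (Re_mul, Im_mul) !(Re_cexp, Im_cexp).
  by rewrite Re_add Im_add expRD cosD; ring.
by rewrite Re_add Im_add expRD sinD; ring.
Qed.

Lemma cexp_real r : cexp r%:C = (expR r)%:C.
Proof. by rewrite /cexp /= cos0 sin0 mulr1. Qed.

Lemma cexp0 : cexp (0 : R[i]) = 1.
Proof. by rewrite (cexp_real 0) expR0. Qed.

Lemma cexpNr z : cexp z * cexp (- z) = 1.
Proof. by rewrite -cexpD subrr cexp0. Qed.

Lemma cexpJ z : cexp z^*%C = (cexp z)^*%C.
Proof.
by case: z => a b; rewrite /cexp /= cosN sinN; simpc.
Qed.

Lemma cexp_sum (I : Type) (s : seq I) (F : I -> R[i]) :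
  cexp (\sum_(i <- s) F i) = \prod_(i <- s) cexp (F i).
Proof. exact: (big_morph _ cexpD cexp0). Qed.

Lemma cexp_2pi_i : cexp ((2 * pi)%:C * 'i : R[i]) = 1.
Proof.
rewrite /cexp Re_mul Im_mul /= !(mulr0, mulr1, mul0r, subr0, addr0).
by rewrite mulr_natl -[pi *+ 2]add0r cosD2pi sinD2pi cos0 sin0 expR0 mulr1.
Qed.

Lemma normc_cexp z : normc (cexp z) = expR (Re z).
Proof.
rewrite /cexp normcM /= expr0n addr0 sqrtr_sqr ger0_norm ?expR_ge0//.
by rewrite cos2Dsin2 sqrtr1 mulr1.
Qed.

Lemma normc_sqrt z : normc z = Num.sqrt (Re z ^+ 2 + Im z ^+ 2).
Proof. by case: z. Qed.

Lemma normc_ge0 z : 0 <= normc z.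
Proof. by rewrite normc_sqrt sqrtr_ge0. Qed.

Lemma normc_real r : normc r%:C = `|r|.
Proof. by rewrite normc_sqrt /= expr0n addr0 sqrtr_sqr. Qed.

Lemma normc_conj (z : R[i]) : normc z^*%C = normc z.
Proof. by case: z => x y /=; rewrite sqrrN. Qed.

Lemma norm_Re_le z : `|Re z| <= normc z.
Proof. by rewrite normc_sqrt -sqrtr_sqr ler_wsqrtr// lerDl sqr_ge0. Qed.

Lemma norm_Im_le z : `|Im z| <= normc z.
Proof. by rewrite normc_sqrt -sqrtr_sqr ler_wsqrtr// lerDr sqr_ge0. Qed.

Lemma normc_le z : normc z <= `|Re z| + `|Im z|.
Proof.
rewrite normc_sqrt -[leRHS]ger0_norm ?addr_ge0// -sqrtr_sqr ler_wsqrtr//.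
rewrite sqrrD !real_normK ?num_real// -addrA lerD2l lerDr.
by rewrite mulrn_wge0// mulr_ge0.
Qed.

Lemma normcX z n : normc (z ^+ n) = normc z ^+ n.
Proof.
elim: n => [|n IHn]; first by rewrite !expr0 normc1.
by rewrite !exprS normcM IHn.
Qed.

(** Working componentwise keeps the real theory applicable: derivation rules, constancy when the
    derivative vanishes, differentiation under the integral sign. *)
Definition is_cderive (h : R -> R[i]) t (d : R[i]) :=
  is_derive t 1 (Re \o h) (Re d) /\ is_derive t 1 (Im \o h) (Im d).

Lemma is_cderive_eq h t d d' : is_cderive h t d -> d = d' -> is_cderive h t d'.
Proof. by move=> ? <-. Qed.

(** Two computations of one derivative become an identity; the moment formula equates in this way an
    integral and a closed form. *)
Lemma is_cderive_unique h t d d' : is_cderive h t d -> is_cderive h t d' -> d = d'.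
Proof.
move=> [hR hI] [hR' hI']; apply: complex_eqP.
  by rewrite -(@derive_val _ _ _ _ _ _ _ hR) (@derive_val _ _ _ _ _ _ _ hR').
by rewrite -(@derive_val _ _ _ _ _ _ _ hI) (@derive_val _ _ _ _ _ _ _ hI').
Qed.

Lemma is_cderive_cst z t : is_cderive (fun=> z) t 0.
Proof. by split; exact: is_derive_cst. Qed.

Lemma is_cderive_real t : is_cderive (fun r => r%:C) t 1.
Proof. by split; [exact: is_derive_id|exact: is_derive_cst]. Qed.

Lemma is_cderiveD g h t d e :
  is_cderive g t d -> is_cderive h t e -> is_cderive (fun r => g r + h r) t (d + e).
Proof.
move=> [g1 g2] [h1 h2]; split.
  rewrite (_ : _ \o _ = (Re \o g) + (Re \o h)).
    by rewrite Re_add; apply: is_deriveD.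
  by apply/funext => r /=; rewrite Re_add.
rewrite (_ : _ \o _ = (Im \o g) + (Im \o h)).
  by rewrite Im_add; apply: is_deriveD.
by apply/funext => r /=; rewrite Im_add.
Qed.

Lemma is_cderiveM g h t d e :
  is_cderive g t d -> is_cderive h t e ->
  is_cderive (fun r => g r * h r) t (g t * e + d * h t).
Proof.
move=> [g1 g2] [h1 h2]; split.
  rewrite (_ : _ \o _ = (Re \o g) * (Re \o h) - (Im \o g) * (Im \o h)).
    apply: is_derive_eq.
    by rewrite /= !(Re_add, Re_mul) /GRing.scale /=; ring.
  by apply/funext => r /=; rewrite Re_mul.
rewrite (_ : _ \o _ = (Re \o g) * (Im \o h) + (Im \o g) * (Re \o h)).
  apply: is_derive_eq.
  by rewrite /= !(Im_add, Im_mul) /GRing.scale /=; ring.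
by apply/funext => r /=; rewrite Im_mul.
Qed.

Lemma is_cderive_cexp g t d :
  is_cderive g t d -> is_cderive (fun r => cexp (g r)) t (d * cexp (g t)).
Proof.
move=> [g1 g2]; split.
  rewrite (_ : _ \o _ = (expR \o (Re \o g)) * (cos \o (Im \o g))).
    apply: is_derive_eq.
    by rewrite (Re_mul, Im_mul) Re_cexp Im_cexp /= /GRing.scale /=; ring.
  by apply/funext => r; exact: Re_cexp.
rewrite (_ : _ \o _ = (expR \o (Re \o g)) * (sin \o (Im \o g))).
  apply: is_derive_eq.
  by rewrite (Re_mul, Im_mul) Re_cexp Im_cexp /= /GRing.scale /=; ring.
by apply/funext => r; exact: Im_cexp.
Qed.

Lemma is_cderive0_cst (h : R -> R[i]) :
  (forall t, is_cderive h t 0) -> forall a b, h a = h b.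
Proof.
move=> h0 a b; apply: complex_eqP.
  by apply: (@is_derive_0_is_cst _ (fun t => complex.Re (h t))) => t; have [] := h0 t.
by apply: (@is_derive_0_is_cst _ (fun t => complex.Im (h t))) => t; have [] := h0 t.
Qed.

End ComplexExponential.

(** * Integrals of complex-valued functions *)

Section ComplexIntegral.
Context {d : measure_display} {T : measurableType d} {R : realType}.
Implicit Types (g h : T -> R[i]) (I J z : R[i]).

Local Notation Re := (@complex.Re R).
Local Notation Im := (@complex.Im R).

Definition cmeasurable h :=
  measurable_fun [set: T] (fun t => Re (h t)) /\
  measurable_fun [set: T] (fun t => Im (h t)).

Lemma cmeasurable_cst z : cmeasurable (fun=> z).
Proof. by split; exact: measurable_cst. Qed.

Lemma cmeasurable_real (f : T -> R) :
  measurable_fun [set: T] f -> cmeasurable (fun t => (f t)%:C).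
Proof. by move=> mf; split=> //; exact: measurable_cst. Qed.

Lemma cmeasurableD g h :
  cmeasurable g -> cmeasurable h -> cmeasurable (fun t => g t + h t).
Proof.
move=> [g1 g2] [h1 h2]; split.
  by under eq_fun do rewrite Re_add; exact: measurable_funD.
by under eq_fun do rewrite Im_add; exact: measurable_funD.
Qed.

Lemma cmeasurableM g h :
  cmeasurable g -> cmeasurable h -> cmeasurable (fun t => g t * h t).
Proof.
move=> [g1 g2] [h1 h2]; split.
  by under eq_fun do rewrite Re_mul; apply: measurable_funB; exact: measurable_funM.
by under eq_fun do rewrite Im_mul; apply: measurable_funD; exact: measurable_funM.
Qed.

Lemma cmeasurableN h : cmeasurable h -> cmeasurable (fun t => - h t).
Proof.
move=> mh; under eq_fun do rewrite -mulN1r.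
by apply: cmeasurableM => //; exact: cmeasurable_cst.
Qed.

Lemma cmeasurableX h n : cmeasurable h -> cmeasurable (fun t => h t ^+ n).
Proof.
move=> mh; elim: n => [|n IHn].
  by under eq_fun do rewrite expr0; exact: cmeasurable_cst.
by under eq_fun do rewrite exprS; exact: cmeasurableM.
Qed.

Lemma cmeasurable_cexp h : cmeasurable h -> cmeasurable (fun t => cexp (h t)).
Proof.
move=> [h1 h2]; split.
  under eq_fun do rewrite Re_cexp; apply: measurable_funM.
    exact: (measurableT_comp (@measurable_expR R)).
  apply: measurableT_comp h2; apply: continuous_measurable_fun.
  exact: continuous_cos.
under eq_fun do rewrite Im_cexp; apply: measurable_funM.
  exact: (measurableT_comp (@measurable_expR R)).
apply: measurableT_comp h2; apply: continuous_measurable_fun.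
exact: continuous_sin.
Qed.

Variable mu : {measure set T -> \bar R}.

Definition cintegral h : R[i] :=
  Rintegral mu [set: T] (fun t => Re (h t)) +i*
  Rintegral mu [set: T] (fun t => Im (h t)).

(** [cintegral] has a value even where the integral diverges, so integrability travels together with
    the value. *)
Definition has_cintegral h I :=
  [/\ mu.-integrable [set: T] (fun t => (Re (h t))%:E),
      mu.-integrable [set: T] (fun t => (Im (h t))%:E) & cintegral h = I].

Lemma has_cintegral_eq h I J : has_cintegral h I -> I = J -> has_cintegral h J.
Proof. by move=> ? <-. Qed.

Lemma has_cintegral_measurable h I : has_cintegral h I -> cmeasurable h.
Proof.
by move=> [/measurable_int/measurable_EFinP ? /measurable_int/measurable_EFinP ? _].
Qed.

Lemma has_cintegral_real (f : T -> R) : mu.-integrable [set: T] (EFin \o f) ->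
  has_cintegral (fun t => (f t)%:C) (Rintegral mu [set: T] f)%:C.
Proof.
move=> mf; split => //=; first exact: integrable0.
by rewrite /cintegral /= Rintegral_cst// mul0r.
Qed.

Lemma has_cintegral0 : has_cintegral (fun=> 0) 0.
Proof.
split; [exact: integrable0|exact: integrable0|].
by rewrite /cintegral !Rintegral_cst// mul0r.
Qed.

Lemma has_cintegralD g h I J : has_cintegral g I -> has_cintegral h J ->
  has_cintegral (fun t => g t + h t) (I + J).
Proof.
move=> [g1 g2 <-] [h1 h2 <-]; split.
- by under eq_fun do rewrite Re_add EFinD; exact: integrableD.
- by under eq_fun do rewrite Im_add EFinD; exact: integrableD.
- rewrite /cintegral; under eq_Rintegral do rewrite Re_add.
  under [X in _ +i* X]eq_Rintegral do rewrite Im_add.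
  by rewrite !RintegralD.
Qed.

Lemma has_cintegralZ z h I : has_cintegral h I ->
  has_cintegral (fun t => z * h t) (z * I).
Proof.
move=> [h1 h2 <-].
have iZ c (f : T -> R) : mu.-integrable [set: T] (EFin \o f) ->
    mu.-integrable [set: T] (EFin \o (fun t => c * f t)).
  by move=> fi; rewrite /comp; under eq_fun do rewrite EFinM; exact: integrableZl.
split.
- under eq_fun do rewrite Re_mul EFinB.
  by apply: integrableB => //; exact: iZ.
- under eq_fun do rewrite Im_mul EFinD.
  by apply: integrableD => //; exact: iZ.
- rewrite /cintegral; under eq_Rintegral do rewrite Re_mul.
  under [X in _ +i* X]eq_Rintegral do rewrite Im_mul.
  rewrite RintegralB ?RintegralD //; try exact: iZ.
  by rewrite !RintegralZl//; case: (z).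
Qed.

Lemma has_cintegral_sum (A : Type) (s : seq A) (P : pred A)
    (h : A -> T -> R[i]) (I : A -> R[i]) :
  (forall i, P i -> has_cintegral (h i) (I i)) ->
  has_cintegral (fun t => \sum_(i <- s | P i) h i t) (\sum_(i <- s | P i) I i).
Proof.
move=> hI; elim: s => [|a s IHs].
  by rewrite big_nil; under eq_fun do rewrite big_nil; exact: has_cintegral0.
rewrite big_cons; under eq_fun do rewrite big_cons.
by case: ifPn => // Pa; apply: has_cintegralD => //; exact: hI.
Qed.

(** Only convergence is at stake here: the value stays [cintegral h], to be identified by other
    means. *)
Lemma has_cintegral_dominated h (G : T -> R) : cmeasurable h ->
  mu.-integrable [set: T] (EFin \o G) -> (forall t, normc (h t) <= G t) ->
  has_cintegral h (cintegral h).
Proof.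
move=> [h1 h2] iG hG; split => //.
- apply: le_integrable iG => //; first exact/measurable_EFinP.
  move=> t _ /=; rewrite lee_fin (le_trans (norm_Re_le _))// (le_trans (hG t))//.
  exact: ler_norm.
- apply: le_integrable iG => //; first exact/measurable_EFinP.
  move=> t _ /=; rewrite lee_fin (le_trans (norm_Im_le _))// (le_trans (hG t))//.
  exact: ler_norm.
Qed.

End ComplexIntegral.

(** * Fubini for products of functions of separate variables *)

Section Product.
Context {d1 d2 : measure_display} {T1 : measurableType d1} {T2 : measurableType d2}.
Context {R : realType}.
Variables (m1 : {sigma_finite_measure set T1 -> \bar R}).
Variables (m2 : {sigma_finite_measure set T2 -> \bar R}).

(** Tonelli: the iterated integral of the absolute value factors into the finite integrals of [|f|]
    and [|g|]. *)
Lemma integrable_tensor (f : T1 -> R) (g : T2 -> R) :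
  m1.-integrable [set: T1] (EFin \o f) -> m2.-integrable [set: T2] (EFin \o g) ->
  (m1 \x m2)%E.-integrable [set: T1 * T2] (fun x => (f x.1 * g x.2)%:E).
Proof.
move=> fi gi.
have mf : measurable_fun [set: T1] f by move: fi => /measurable_int/measurable_EFinP.
have mg : measurable_fun [set: T2] g by move: gi => /measurable_int/measurable_EFinP.
apply/integrable12ltyP.
  apply/measurable_EFinP; apply: measurable_funM.
    exact: measurableT_comp mf measurable_fst.
  exact: measurableT_comp mg measurable_snd.
move/integrableP: (fi) => [_ fi']; move/integrableP: (gi) => [_ gi'].
have absM x : (\int[m2]_y `|(f x * g y)%:E| = `|f x|%:E * \int[m2]_y `|(g y)%:E|)%E.
  under eq_integral => y _ do rewrite abse_EFin normrM EFinM.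
  rewrite ge0_integralZl//.
  by apply/measurable_EFinP; exact: measurableT_comp mg.
under eq_integral do rewrite absM.
rewrite ge0_integralZr//.
- rewrite lte_mul_pinfty ?integral_ge0// ge0_fin_numE ?integral_ge0//.
- by apply/measurable_EFinP; exact: measurableT_comp mf.
- exact: integral_ge0.
Qed.

Lemma Rintegral_tensor (f : T1 -> R) (g : T2 -> R) :
  m1.-integrable [set: T1] (EFin \o f) -> m2.-integrable [set: T2] (EFin \o g) ->
  Rintegral (m1 \x m2)%E [set: T1 * T2] (fun x => f x.1 * g x.2) =
  Rintegral m1 [set: T1] f * Rintegral m2 [set: T2] g.
Proof.
move=> fi gi; have fgi := integrable_tensor fi gi.
rewrite /Rintegral -(integral12_prod_meas1 fgi) /fubini_F /=.
under eq_integral => x _.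
  under eq_integral => y _ do rewrite EFinM.
  rewrite integralZl// -[X in (_ * X)%E]fineK ?integrable_fin_num// muleC; over.
rewrite integralZl// [in RHS]mulrC -fineM ?integrable_fin_num//.
by rewrite fineK ?integrable_fin_num.
Qed.

(** The real and imaginary parts of the product expand into four real products, each covered by the
    real case. *)
Lemma has_cintegral_tensor (f : T1 -> R[i]) (g : T2 -> R[i]) I J :
  has_cintegral m1 f I -> has_cintegral m2 g J ->
  has_cintegral (m1 \x m2)%E (fun x => f x.1 * g x.2) (I * J).
Proof.
move=> [f1 f2 <-] [g1 g2 <-].
have RR := integrable_tensor f1 g1; have II := integrable_tensor f2 g2.
have RI := integrable_tensor f1 g2; have IR := integrable_tensor f2 g1.
split.
- by under eq_fun do rewrite Re_mul EFinB; exact: integrableB.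
- by under eq_fun do rewrite Im_mul EFinD; exact: integrableD.
- rewrite /cintegral; under eq_Rintegral do rewrite Re_mul.
  under [X in _ +i* X]eq_Rintegral do rewrite Im_mul.
  rewrite RintegralB ?RintegralD//.
  by rewrite (Rintegral_tensor f1 g1) (Rintegral_tensor f2 g2)
             (Rintegral_tensor f1 g2) (Rintegral_tensor f2 g1).
Qed.

End Product.

(** * Differentiation under the integral sign *)

Section DerivativeUnderIntegral.
Context {d : measure_display} {T : measurableType d} {R : realType}.
Variable mu : {measure set T -> \bar R}.

(** Domination is asked only at distance less than 1 from [a], which suits exponentials whose rate
    of growth increases with [r]. *)
Lemma is_derive_under_Rintegral (f f' : R -> T -> R) (a : R) (G : T -> R) :
  (forall r, mu.-integrable [set: T] (EFin \o f r)) ->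
  (forall (r : R) y, is_derive r 1 (f ^~ y) (f' r y)) ->
  mu.-integrable [set: T] (EFin \o G) ->
  (forall r y, a - 1 < r < a + 1 -> `|f' r y| <= G y) ->
  is_derive a 1 (fun r => Rintegral mu [set: T] (f r))
    (Rintegral mu [set: T] (f' a)).
Proof.
move=> fi fd Gi fG.
have d1 r y : partial1of2 f r y = f' r y by rewrite partial1of2E derive_val.
have aa : [set` `]a - 1, a + 1[] a.
  by rewrite /= in_itv/= ltrDl ltr01 andbT ltrBlDr ltrDl.
have fd' (r : R) y : [set` `]a - 1, a + 1[] r -> [set: T] y -> derivable (f ^~ y) r 1.
  by move=> _ _; have [] := fd r y.
have G0 y : 0 <= G y.
  by rewrite (le_trans _ (fG a y _))//; have := aa; rewrite /= in_itv.
have dG r y : [set` `]a - 1, a + 1[] r -> [set: T] y -> `|partial1of2 f r y| <= G y.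
  by rewrite /= in_itv/= d1 => ra _; exact: fG.
have fi' r : [set` `]a - 1, a + 1[] r -> mu.-integrable [set: T] (EFin \o f r) by [].
apply: DeriveDef.
  exact: (derivable_under_integral measurableT aa fi' fd' G0 Gi dG).
rewrite -derive1E (differentiation_under_integral measurableT aa fi' fd' G0 Gi dG).
by apply: eq_Rintegral => y _; rewrite d1.
Qed.

(** The form [u exp (r v)] covers both later uses: scaling the linear exponent [s x], and
    translating [b]. [I] may be any expression of the integral, in particular a closed form. *)
Lemma is_cderive_under_cintegral (u v : T -> R[i]) (I : R -> R[i]) (a : R)
    (G : T -> R) :
  (forall r, has_cintegral mu (fun y => u y * cexp (r%:C * v y)) (I r)) ->
  mu.-integrable [set: T] (EFin \o G) ->
  (forall r y, a - 1 < r < a + 1 ->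
     normc (u y * v y * cexp (r%:C * v y)) <= G y) ->
  is_cderive I a (cintegral mu (fun y => u y * v y * cexp (a%:C * v y))).
Proof.
move=> hI Gi uvG.
have fd r y : is_cderive (fun r => u y * cexp (r%:C * v y)) r
    (u y * v y * cexp (r%:C * v y)).
  apply: is_cderive_eq.
    apply: is_cderiveM; first exact: is_cderive_cst.
    apply: is_cderive_cexp; apply: is_cderiveM; first exact: is_cderive_real.
    exact: is_cderive_cst.
  by rewrite /=; ring.
split.
- rewrite (_ : _ \o _ = fun r => Rintegral mu [set: T]
    (fun y => complex.Re (u y * cexp (r%:C * v y)))); last first.
    by apply/funext => r /=; have [_ _ <-] := hI r.
  apply: (@is_derive_under_Rintegral _
    (fun r y => complex.Re (u y * v y * cexp (r%:C * v y))) a G) => [r|r y|//|r y ra].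
  + by have [] := hI r.
  + by have [] := fd r y.
  + exact: le_trans (norm_Re_le _) (uvG _ _ ra).
- rewrite (_ : _ \o _ = fun r => Rintegral mu [set: T]
    (fun y => complex.Im (u y * cexp (r%:C * v y)))); last first.
    by apply/funext => r /=; have [_ _ <-] := hI r.
  apply: (@is_derive_under_Rintegral _
    (fun r y => complex.Im (u y * v y * cexp (r%:C * v y))) a G) => [r|r y|//|r y ra].
  + by have [] := hI r.
  + by have [] := fd r y.
  + exact: le_trans (norm_Im_le _) (uvG _ _ ra).
Qed.

End DerivativeUnderIntegral.

(** * The Gaussian integral on the line *)

Section RealLine.
Variable R : realType.
Local Notation leb := (@lebesgue_measure R).
Implicit Types (s z : R[i]) (x A : R).

Lemma is_derive_continuous (f f' : R -> R) :
  (forall x, is_derive x 1 f (f' x)) -> continuous f.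
Proof.
move=> df x; apply/differentiable_continuous/derivable1_diffP.
by have [] := df x.
Qed.

(** The fundamental theorem of calculus gives the integral over [[-(n+1), n+1]] as a difference of
    boundary values, which tends to 0; dominated convergence, with bound [|f'|], passes to the whole
    line. *)
Lemma Rintegral_derive_eq0 (f f' : R -> R) :
  (forall x, is_derive x 1 f (f' x)) -> continuous f' ->
  leb.-integrable [set: R] (EFin \o f') ->
  f n.+1%:R @[n --> \oo] --> (0 : R) -> f (- n.+1%:R) @[n --> \oo] --> (0 : R) ->
  Rintegral leb [set: R] f' = 0.
Proof.
move=> df cf' fi fy fNy.
(* The successor keeps the interval nondegenerate for [n = 0]. *)
pose D n : set R := [set` `[- n.+1%:R, n.+1%:R]].
have FTC n : (\int[leb]_(x in D n) (f' x)%:E = (f n.+1%:R)%:E - (f (- n.+1%:R))%:E)%E.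
  have cf := is_derive_continuous df.
  apply: continuous_FTC2.
  - by rewrite -subr_gt0 opprK addr_gt0// ltr0n.
  - exact: continuous_subspaceT.
  - split=> [x _| |]; first by have [] := df x.
      exact/cvg_at_right_filter/cf.
    exact/cvg_at_left_filter/cf.
  - by move=> x _; rewrite derive1E; have [] := df x.
have mD n : measurable (D n) by exact: measurable_itv.
have cvgD x : [set: R] x ->
    ((EFin \o f') \_ (D n)) x @[n --> \oo] --> (EFin \o f') x.
  move=> _; apply: cvg_near_cst; near=> n.
  rewrite /patch mem_set// /D /= in_itv /= -ler_norml.
  rewrite (@le_trans _ _ n%:R)// ?ler_nat//.
  by near: n; exact: nbhs_infty_ger.
have domD x n : [set: R] x -> (`|((EFin \o f') \_ (D n)) x| <= `|(EFin \o f') x|)%E.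
  by move=> _; rewrite /patch; case: ifP => // _; rewrite abse0 abse_ge0.
have lim : (\int[leb]_x ((EFin \o f') \_ (D n)) x)%E @[n --> \oo] -->
    (\int[leb]_x (EFin \o f') x)%E.
  have [] // := @dominated_convergence _ _ _ leb [set: R] measurableT
    (fun n => (EFin \o f') \_ (D n)) (EFin \o f') (abse \o (EFin \o f')).
  - move=> n; apply/(measurable_restrictT _ (mD n)).
    exact: measurable_funTS (measurable_int _ fi).
  - exact: measurable_int fi.
  - by apply: aeW => x; exact: cvgD.
  - exact: integrable_abse.
  - by apply: aeW => x n; exact: domD.
have lim0 : (\int[leb]_(x in [set: R]) (EFin \o f') x = 0)%E.
  have intD n : (\int[leb]_x ((EFin \o f') \_ (D n)) x =
      (f n.+1%:R - f (- n.+1%:R))%:E)%E.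
    by rewrite -integral_mkcond FTC.
  apply: cvg_unique lim _ => //; rewrite (funext intD).
  have := cvgB fy fNy; rewrite subr0 => fB.
  by apply: cvg_EFin; [exact: nearW|exact: fB].
by rewrite /Rintegral lim0.
Unshelve. all: by end_near. Qed.

(* [A |x| <= A^2 / 2 + x^2 / 2], so half of the Gaussian decay absorbs an
   exponential of any rate. *)
Lemma integrable_expR_abs_sqr A :
  leb.-integrable [set: R] (EFin \o (fun x => expR (A * `|x| - x ^+ 2))).
Proof.
(* Dividing by the peak cancels the normalization of the normal density, so that
   [c * normal_pdf 0 1 x] is [exp (A^2 / 2 - x^2 / 2)]. *)
pose c : R := expR (A ^+ 2 / 2) / normal_peak 1.
have iG : leb.-integrable [set: R] (EFin \o (fun x => c * normal_pdf 0 1 x)).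
  rewrite /comp; under eq_fun do rewrite EFinM.
  by apply: integrableZl => //; exact: integrable_normal_pdf.
apply: le_integrable iG => //.
  apply/measurable_EFinP; apply: measurableT_comp => //.
  by apply: measurable_funB => //; exact: measurable_funM.
move=> x _.
have cG0 : 0 <= c * normal_pdf 0 1 x.
  by rewrite mulr_ge0 ?divr_ge0 ?expR_ge0 ?normal_peak_ge0 ?normal_pdf_ge0.
rewrite /= lee_fin (ger0_norm (expR_ge0 _)) (ger0_norm cG0).
rewrite normal_pdfE ?oner_neq0// mulrA divfK; last first.
  by rewrite gt_eqF// normal_peak_gt0 ?oner_neq0.
rewrite /normal_fun -expRD ler_expR subr0 expr1n.
have := sqr_ge0 (A - `|x|); rewrite sqrrB real_normK ?num_real//.
lra.
Qed.

(** Completing the square gives [A y - y^2 <= (A + 1)^2 / 4 - y] for [y = n + 1]. The hypothesis on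
    [f] serves both endpoints [n + 1] and [-(n + 1)]. *)
Lemma cvg_expR_abs_sqr A (f : nat -> R) : (forall n, `|f n| = n.+1%:R) ->
  expR (A * `|f n| - f n ^+ 2) @[n --> \oo] --> (0 : R).
Proof.
move=> fn; apply: (@squeeze_cvgr _ _ _ _ (cst 0)
    (fun n => expR ((A + 1) ^+ 2 / 4) * expR (- n.+1%:R))).
- apply: nearW => n; rewrite expR_ge0 /= -expRD ler_expR.
  rewrite -[f n ^+ 2]real_normK ?num_real// fn.
  have := sqr_ge0 (n.+1%:R - (A + 1) / 2); rewrite sqrrB.
  lra.
- exact: cvg_cst.
- rewrite -[X in _ --> X](mulr0 (expR ((A + 1) ^+ 2 / 4))).
  apply: cvgMr.
  by have := @cvgn_expR R; rewrite -cvg_shiftS.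
Qed.

End RealLine.

(** * Gaussian integrals with a complex linear exponent: convergence and integration by parts *)

Section GaussianFourier.
Variable R : realType.
Local Notation leb := (@lebesgue_measure R).
Implicit Types (s z : R[i]) (x A : R).

Lemma cmeasurable_id : cmeasurable (fun x : measurableTypeR R => x%:C).
Proof. exact: cmeasurable_real. Qed.

Lemma normc_gauss_le s x A : `|complex.Re s| <= A ->
  normc (cexp (s * x%:C - x%:C ^+ 2)) <= expR (A * `|x| - x ^+ 2).
Proof.
move=> sA; rewrite normc_cexp ler_expR Re_add Re_opp -rmorphXn Re_mul /= mulr0 subr0.
rewrite lerD2r (le_trans (ler_norm _))// normrM.
by rewrite ler_wpM2r.
Qed.

Lemma cmeasurable_gauss s :
  cmeasurable (fun x : measurableTypeR R => cexp (s * x%:C - x%:C ^+ 2)).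
Proof.
apply: cmeasurable_cexp; apply: cmeasurableD.
  by apply: cmeasurableM; [exact: cmeasurable_cst|exact: cmeasurable_id].
by apply: cmeasurableN; apply: cmeasurableX; exact: cmeasurable_id.
Qed.

Lemma has_cintegral_gauss0 s :
  let h x := cexp (s * x%:C - x%:C ^+ 2) in has_cintegral leb h (cintegral leb h).
Proof.
apply: has_cintegral_dominated (integrable_expR_abs_sqr (normc s)) _.
  exact: cmeasurable_gauss.
by move=> x; apply: normc_gauss_le; exact: norm_Re_le.
Qed.

(** The factor [|x|] is at most [exp |x|], which raises the rate by 1. *)
Lemma normc_id_gauss_le s x A : `|complex.Re s| <= A ->
  normc (x%:C * cexp (s * x%:C - x%:C ^+ 2)) <= expR ((A + 1) * `|x| - x ^+ 2).
Proof.
move=> sA; rewrite normcM (_ : (A + 1) * `|x| - x ^+ 2 = `|x| + (A * `|x| - x ^+ 2)).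
  rewrite expRD ler_pM ?normc_ge0//; last exact: normc_gauss_le.
  rewrite normc_sqrt /= expr0n addr0 sqrtr_sqr.
  by rewrite (le_trans _ (expR_ge1Dx _))// lerDr.
by ring.
Qed.

Lemma has_cintegral_gauss1 s :
  let h x := x%:C * cexp (s * x%:C - x%:C ^+ 2) in
  has_cintegral leb h (cintegral leb h).
Proof.
apply: has_cintegral_dominated (integrable_expR_abs_sqr (normc s + 1)) _.
  by apply: cmeasurableM; [exact: cmeasurable_id|exact: cmeasurable_gauss].
by move=> x; apply: normc_id_gauss_le; exact: norm_Re_le.
Qed.

Lemma is_cderive_gauss s x :
  is_cderive (fun x => cexp (s * x%:C - x%:C ^+ 2)) x
    ((s - 2 * x%:C) * cexp (s * x%:C - x%:C ^+ 2)).
Proof.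
apply: is_cderive_eq.
  apply: (@is_cderive_cexp _ (fun x => s * x%:C - x%:C ^+ 2)).
  under eq_fun do rewrite -mulN1r expr2.
  apply: is_cderiveD; apply: is_cderiveM; try exact: is_cderive_cst.
    exact: is_cderive_real.
  apply: is_cderiveM; exact: is_cderive_real.
by lazy beta; ring.
Qed.

(** This second derivative serves to show that the first one is continuous, as the fundamental
    theorem of calculus requires. *)
Lemma is_cderive_gauss' s x :
  is_cderive (fun x => (s - 2 * x%:C) * cexp (s * x%:C - x%:C ^+ 2)) x
    ((s - 2 * x%:C) * ((s - 2 * x%:C) * cexp (s * x%:C - x%:C ^+ 2))
     + (0 + - 2 * 1) * cexp (s * x%:C - x%:C ^+ 2)).
Proof.
apply: is_cderive_eq.
  apply: is_cderiveM; last exact: is_cderive_gauss.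
  apply: is_cderiveD; first exact: is_cderive_cst.
  under eq_fun do rewrite -mulNr.
  by apply: is_cderiveM; [exact: is_cderive_cst|exact: is_cderive_real].
by lazy beta; ring.
Qed.

(** Integration by parts: [(s - 2 x) exp (s x - x^2)] is the derivative of a function that vanishes
    at both infinities, so its integral [s J0 - 2 J1] is 0. *)
Lemma cintegral_gauss1 s :
  cintegral leb (fun x => x%:C * cexp (s * x%:C - x%:C ^+ 2)) =
  s / 2 * cintegral leb (fun x => cexp (s * x%:C - x%:C ^+ 2)).
Proof.
have h0 := has_cintegral_gauss0 s; have h1 := has_cintegral_gauss1 s.
move: h0 h1; lazy zeta.
move: (cintegral _ _) (cintegral _ _) => J1 J0 h0 h1.
have [iR iI J] : has_cintegral leb
    (fun x => (s - 2 * x%:C) * cexp (s * x%:C - x%:C ^+ 2)) (s * J0 + - 2 * J1).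
  rewrite (_ : (fun x => (s - 2 * x%:C) * _) = fun x =>
    s * cexp (s * x%:C - x%:C ^+ 2) + - 2 * (x%:C * cexp (s * x%:C - x%:C ^+ 2))).
    exact: has_cintegralD (has_cintegralZ s h0) (has_cintegralZ (- 2) h1).
  by apply/funext => x; ring.
(* Decay of the boundary terms, for [p] the real or the imaginary part and [f] either sequence of
   endpoints. *)
have cvg0 (p : R[i] -> R) (f : nat -> R) : (forall z, `|p z| <= normc z) ->
    (forall n, `|f n| = n.+1%:R) ->
    p (cexp (s * (f n)%:C - (f n)%:C ^+ 2)) @[n --> \oo] --> (0 : R).
  move=> pn fn; apply: norm_cvg0.
  apply: (squeeze_cvgr _ (cvg_cst 0) (cvg_expR_abs_sqr (normc s) fn)).
  apply: nearW => n; rewrite normr_ge0 /= (le_trans (pn _))// normc_gauss_le//.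
  exact: norm_Re_le.
have nS n : `|n.+1%:R : R| = n.+1%:R by rewrite normr_nat.
have nNS n : `|- n.+1%:R : R| = n.+1%:R by rewrite normrN.
have J' : cintegral leb (fun x => (s - 2 * x%:C) * cexp (s * x%:C - x%:C ^+ 2)) = 0.
  apply: complex_eqP => /=.
  - apply: (@Rintegral_derive_eq0 _ (fun x => complex.Re (cexp (s * x%:C - x%:C ^+ 2)))).
    + by move=> x; have [] := is_cderive_gauss s x.
    + by apply: is_derive_continuous => x; have [] := is_cderive_gauss' s x.
    + exact: iR.
    + exact: (cvg0 (@complex.Re R) _ (@norm_Re_le R) nS).
    + exact: (cvg0 (@complex.Re R) _ (@norm_Re_le R) nNS).
  - apply: (@Rintegral_derive_eq0 _ (fun x => complex.Im (cexp (s * x%:C - x%:C ^+ 2)))).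
    + by move=> x; have [] := is_cderive_gauss s x.
    + by apply: is_derive_continuous => x; have [] := is_cderive_gauss' s x.
    + exact: iI.
    + exact: (cvg0 (@complex.Im R) _ (@norm_Im_le R) nS).
    + exact: (cvg0 (@complex.Im R) _ (@norm_Im_le R) nNS).
have -> : J1 = s / 2 * J0 - (s * J0 + - 2 * J1) / 2 by field.
by rewrite -J J'; ring.
Qed.

End GaussianFourier.

(** * The value of the Gaussian integral through a differential equation *)

Section GaussianIntegral.
Variable R : realType.
Local Notation leb := (@lebesgue_measure R).
Implicit Types (s z : R[i]) (x A : R).

(* [I t], the integral of [exp (t s x - x^2)], solves [I' = (t s^2 / 2) I]. *)
Lemma is_cderive_cintegral_gauss s a :
  let I (t : R) := cintegral leb (fun x => cexp (t%:C * s * x%:C - x%:C ^+ 2)) in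
  is_cderive I a (s * (a%:C * s / 2 * I a)).
Proof.
(* [A] bounds the modulus of [t s] for all [t] within 1 of [a]. *)
move=> I; pose A := (`|a| + 1) * normc s.
have uvE (t : R) x : cexp (- x%:C ^+ 2) * cexp (t%:C * (s * x%:C)) =
    cexp (t%:C * s * x%:C - x%:C ^+ 2).
  by rewrite -cexpD; congr cexp; ring.
have uvE' (t : R) x : cexp (- x%:C ^+ 2) * (s * x%:C) * cexp (t%:C * (s * x%:C)) =
    s * (x%:C * cexp (t%:C * s * x%:C - x%:C ^+ 2)).
  by rewrite -uvE; ring.
apply: is_cderive_eq.
  apply: (@is_cderive_under_cintegral _ _ _ leb (fun x => cexp (- x%:C ^+ 2))
    (fun x => s * x%:C) _ _ (fun x => normc s * expR ((A + 1) * `|x| - x ^+ 2))).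
  - move=> t; under eq_fun do rewrite uvE.
    exact: has_cintegral_gauss0.
  - rewrite /comp; under eq_fun do rewrite EFinM.
    by apply: integrableZl => //; exact: integrable_expR_abs_sqr.
  - move=> t x /andP[at1 ta1]; rewrite uvE' normcM ler_wpM2l ?normc_ge0//.
    apply: normc_id_gauss_le; rewrite (le_trans (norm_Re_le _))// normcM normc_real.
    rewrite ler_wpM2r ?normc_ge0//.
    rewrite -[t](subrK a) addrC (le_trans (ler_normD _ _))// lerD2l ler_norml.
    by apply/andP; split; lra.
under eq_fun do rewrite uvE'.
(* Integration by parts turns the differentiated integral into a multiple of [I a]. *)
rewrite -cintegral_gauss1.
by have [] := has_cintegralZ s (has_cintegral_gauss1 (a%:C * s)).
Qed.

(** By the differential equation, [K t = I t exp (- t^2 s^2 / 4)] is constant. At [t = 1] it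
    contains the desired integral; at [t = 0] it is the classical real integral [sqrt pi]. *)
Lemma has_cintegral_gauss s :
  has_cintegral leb (fun x => cexp (s * x%:C - x%:C ^+ 2))
    ((Num.sqrt pi)%:C * cexp (s ^+ 2 / 4)).
Proof.
apply: has_cintegral_eq (has_cintegral_gauss0 s) _.
pose I (t : R) := cintegral leb (fun x => cexp (t%:C * s * x%:C - x%:C ^+ 2)).
pose K (t : R) := I t * cexp (t%:C * t%:C * (- (s ^+ 2 / 4))).
have K0 t : is_cderive K t 0.
  apply: is_cderive_eq.
    apply: is_cderiveM; first exact: is_cderive_cintegral_gauss.
    apply: is_cderive_cexp; apply: is_cderiveM; last exact: is_cderive_cst.
    by apply: is_cderiveM; exact: is_cderive_real.
  by rewrite /I; lazy beta; field.
have I0 : I 0 = (Num.sqrt pi)%:C.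
  rewrite /I; under eq_fun do
    rewrite rmorph0 !mul0r add0r -rmorphXn -rmorphN cexp_real -/(gauss_fun _).
  have [_ _ ->] := has_cintegral_real (@integrableT_gauss R).
  by rewrite /Rintegral integralT_gauss.
have := is_cderive0_cst K0 1 0.
rewrite /K I0 rmorph0 rmorph1 !mul0r !mul1r cexp0 mulr1 => <-.
rewrite -mulrA [cexp (- _) * _]mulrC cexpNr mulr1 /I.
by under [in RHS]eq_fun do rewrite rmorph1 mul1r.
Qed.

End GaussianIntegral.

(** * Gaussian moments in the complex plane *)

Section GaussianPlane.
Variable R : realType.
Local Notation leb := (@lebesgue_measure R).
Implicit Types (b c : R[i]) (q : plane R) (m : nat).

Definition to_C q : R[i] := q.1 +i* q.2.

(* The weight of [b . w + c . conj w] in one complex variable, times the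
   unnormalized density [exp (- |w|^2)] of the Gaussian measure. *)
Definition gauss_exp b c q : R[i] :=
  cexp (b * to_C q + c * (to_C q)^*%C - to_C q * (to_C q)^*%C).

Lemma to_CE q : to_C q = q.1%:C + 'i * q.2%:C.
Proof. by rewrite /to_C; simpc. Qed.

Lemma conj_to_CE q : (to_C q)^*%C = q.1%:C - 'i * q.2%:C.
Proof. by rewrite /to_C; simpc. Qed.

(** In the coordinates [w = x + i y] the exponent separates, so that Fubini applies. *)
Lemma gauss_expE b c q : gauss_exp b c q =
  cexp ((b + c) * q.1%:C - q.1%:C ^+ 2) * cexp ('i * (b - c) * q.2%:C - q.2%:C ^+ 2).
Proof.
rewrite /gauss_exp -cexpD conj_to_CE to_CE; congr cexp.
have -> : (q.1%:C + 'i * q.2%:C) * (q.1%:C - 'i * q.2%:C) =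
    q.1%:C ^+ 2 - 'i ^+ 2 * q.2%:C ^+ 2 by ring.
by rewrite sqr_i; ring.
Qed.

(** The two one-dimensional values multiply to this one because
    [((b + c)^2 + (i (b - c))^2) / 4 = b c]. *)
Lemma has_cintegral_gauss_exp b c :
  has_cintegral (@lebesgue_plane R) (gauss_exp b c) (pi%:C * cexp (b * c)).
Proof.
rewrite (funext (gauss_expE b c)).
apply: has_cintegral_eq (has_cintegral_tensor (has_cintegral_gauss (b + c))
  (has_cintegral_gauss ('i * (b - c)))) _.
rewrite mulrACA -rmorphM -expr2 sqr_sqrtr ?pi_ge0// -cexpD; congr (_ * cexp _).
by rewrite exprMn sqr_i; field.
Qed.

Lemma cmeasurable_to_C : cmeasurable to_C.
Proof. by split; [exact: measurable_fst|exact: measurable_snd]. Qed.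

Lemma cmeasurable_gauss_exp b c : cmeasurable (gauss_exp b c).
Proof. exact: has_cintegral_measurable (has_cintegral_gauss_exp b c). Qed.

(** With [r = |w|], [r^m <= exp (m r)] and the linear exponent has real part at most
    [(|b| + |c|) r], while [r <= |x| + |y|]. Only the moduli of [b] and [c] enter, so one [B] serves
    all [b] in a ball. *)
Lemma normc_gauss_exp_le b c m q (B : R) :
  m%:R + normc b + normc c <= B ->
  normc (to_C q ^+ m * gauss_exp b c q) <=
  expR (B * `|q.1| - q.1 ^+ 2) * expR (B * `|q.2| - q.2 ^+ 2).
Proof.
move=> mB; rewrite normcM normcX normc_cexp.
have r0 := normc_ge0 (to_C q).
have rle : normc (to_C q) <= `|q.1| + `|q.2| := normc_le (to_C q).
have := norm_Re_le (b * to_C q); have := norm_Re_le (c * (to_C q)^*%C).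
rewrite !normcM normc_conj !Re_add Re_opp (_ : complex.Re (to_C q * _) =
  q.1 ^+ 2 + q.2 ^+ 2); last by rewrite Re_mul /=; ring.
move: (normc (to_C q)) r0 rle => r r0 rle hc hb.
have rm : r ^+ m <= expR (m%:R * r).
  rewrite expRM_natl lerXn2r ?nnegrE ?expR_ge0//.
  by rewrite (le_trans _ (expR_ge1Dx _))// lerDr.
rewrite -expRD (le_trans (ler_wpM2r (expR_ge0 _) rm))// -expRD ler_expR.
have hb' := le_trans (ler_norm _) hb; have hc' := le_trans (ler_norm _) hc.
have B0 : 0 <= B by rewrite (le_trans _ mB)// !addr_ge0 ?normc_ge0.
have Br : (m%:R + normc b + normc c) * r <= B * (`|q.1| + `|q.2|).
  by rewrite ler_pM// !addr_ge0 ?normc_ge0.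
lra.
Qed.

Lemma integrable_plane_dominating (B : R) :
  (@lebesgue_plane R).-integrable [set: plane R]
    (EFin \o (fun q => expR (B * `|q.1| - q.1 ^+ 2) * expR (B * `|q.2| - q.2 ^+ 2))).
Proof.
exact: integrable_tensor (integrable_expR_abs_sqr B) (integrable_expR_abs_sqr B).
Qed.

(* The moments are obtained by differentiating along the real direction
   [b + t] under the integral sign, at [t = 0]. *)
Lemma has_cintegral_moment m b c :
  has_cintegral (@lebesgue_plane R) (fun q => to_C q ^+ m * gauss_exp b c q)
    (pi%:C * c ^+ m * cexp (b * c)).
Proof.
elim: m b => [|m IHm] b.
  rewrite expr0 mulr1; under eq_fun do rewrite expr0 mul1r.
  exact: has_cintegral_gauss_exp.
pose u q := to_C q ^+ m * gauss_exp b c q.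
have uE (t : R) q : u q * cexp (t%:C * to_C q) =
    to_C q ^+ m * gauss_exp (b + t%:C) c q.
  by rewrite /u -mulrA -cexpD; congr (_ * cexp _); ring.
have uE' (t : R) q : u q * to_C q * cexp (t%:C * to_C q) =
    to_C q ^+ m.+1 * gauss_exp (b + t%:C) c q.
  by rewrite mulrAC uE exprSr; ring.
(* Degree [m + 1] because differentiation brings down a factor [w]; [|b| + 1] bounds [|b + t|] for
   [|t| < 1]. *)
pose B := m.+1%:R + (normc b + 1) + normc c.
have dI : is_cderive (fun t => pi%:C * c ^+ m * cexp ((b + t%:C) * c)) 0
    (cintegral (@lebesgue_plane R)
      (fun q => u q * to_C q * cexp (0%:C * to_C q))).
  apply: (is_cderive_under_cintegral _ (integrable_plane_dominating B)).
    move=> t; under eq_fun do rewrite uE; exact: IHm.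
  move=> t q /andP[t0 t1]; rewrite uE'; apply: normc_gauss_exp_le.
  rewrite lerD2r lerD2l (le_trans (le_normcD _ _))// lerD2l normc_real ler_norml.
  by apply/andP; split; lra.
(* The same function of [t], now differentiated in closed form. *)
have dI' : is_cderive (fun t => pi%:C * c ^+ m * cexp ((b + t%:C) * c)) 0
    (pi%:C * c ^+ m.+1 * cexp (b * c)).
  apply: is_cderive_eq.
    apply: is_cderiveM; first exact: is_cderive_cst.
    apply: is_cderive_cexp; apply: is_cderiveM; last exact: is_cderive_cst.
    by apply: is_cderiveD; [exact: is_cderive_cst|exact: is_cderive_real].
  by lazy beta; rewrite rmorph0 addr0 exprS; ring.
rewrite (is_cderive_unique dI' dI).
under [X in cintegral _ X]eq_fun do rewrite uE' rmorph0 addr0.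
(* The comparison of derivatives gives the value only; convergence of the new integral is shown
   separately. *)
apply: has_cintegral_dominated (integrable_plane_dominating B) _.
  apply: cmeasurableM; last exact: cmeasurable_gauss_exp.
  by apply: cmeasurableX; exact: cmeasurable_to_C.
move=> q; apply: normc_gauss_exp_le; rewrite lerD2r lerD2l lerDl; lra.
Qed.

End GaussianPlane.

(** * Gaussian moments in several complex variables *)

Section TupleProduct.
Variable R : realType.
Local Notation Cn_measure := (lebesgue_Cn R).

Lemma cmeasurable_prod {d} {T : measurableType d} n (h : 'I_n -> T -> R[i]) :
  (forall k, cmeasurable (h k)) -> cmeasurable (fun t => \prod_(k < n) h k t).
Proof.
elim: n h => [|n IHn] h mh.
  by under eq_fun do rewrite big_ord0; exact: cmeasurable_cst.
under eq_fun do rewrite big_ord_recl.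
by apply: cmeasurableM => //; exact: IHn.
Qed.

Lemma cmeasurable_tnth n (k : 'I_n) (h : plane R -> R[i]) : cmeasurable h ->
  cmeasurable (fun t : n.-tuple (plane R) => h (tnth t k)).
Proof.
by move=> [h1 h2]; split; [move: h1|move: h2] => mh;
  exact: (measurableT_comp mh (measurable_tnth k)).
Qed.

(** Change of variables. The two measures are compared as set functions, since [nu] may carry a
    measure structure of its own. *)
Lemma has_cintegral_pushforward d1 d2 (T1 : measurableType d1)
    (T2 : measurableType d2) (phi : T1 -> T2) (mphi : measurable_fun [set: T1] phi)
    (mu : {measure set T1 -> \bar R}) (nu : {measure set T2 -> \bar R})
    (h : T2 -> R[i]) I :
  nu = pushforward mu phi :> (set T2 -> \bar R) ->
  cmeasurable h -> has_cintegral mu (h \o phi) I -> has_cintegral nu h I.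
Proof.
move=> nuE [h1 h2] [i1 i2 <-].
have mE (f : T2 -> R) : measurable_fun [set: T2] f ->
    measurable_fun [set: T2] (EFin \o f) by move=> ?; exact/measurable_EFinP.
rewrite /has_cintegral /cintegral /Rintegral nuE; split.
- exact: (integrable_pushforward mphi (mE _ h1)).
- exact: (integrable_pushforward mphi (mE _ h2)).
- rewrite (integral_pushforward mphi (mE _ h1))//.
  by rewrite (integral_pushforward mphi (mE _ h2)).
Qed.

Lemma has_cintegral_tuple n (h : 'I_n -> plane R -> R[i]) (I : 'I_n -> R[i]) :
  (forall k, has_cintegral (@lebesgue_plane R) (h k) (I k)) ->
  has_cintegral (Cn_measure n) (fun t => \prod_(k < n) h k (tnth t k))
    (\prod_(k < n) I k).
Proof.
elim: n h I => [|n IHn] h I hI.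
  (* In dimension 0 the measure is a unit mass at the empty tuple, and the empty product 1 has
     integral 1. *)
  rewrite big_ord0; under eq_fun do rewrite big_ord0.
  have i1 : (lebesgue_Cn R 0).-integrable [set: 0.-tuple (plane R)] (EFin \o cst 1).
    exact: (@finite_measure_integrable_cst _ _ _
      (@dirac _ (0.-tuple (plane R)) [tuple] R)).
  apply: has_cintegral_eq (has_cintegral_real i1) _.
  by rewrite Rintegral_cst// mul1r [X in fine X](@diracT _ (0.-tuple (plane R)) R).
have mh : cmeasurable (fun t => \prod_(k < n.+1) h k (tnth t k)).
  apply: cmeasurable_prod => k; apply: cmeasurable_tnth.
  exact: has_cintegral_measurable (hI k).
rewrite big_ord_recl.
apply: (@has_cintegral_pushforward _ _ _ _ (@cons_plane R n)
  (@measurable_cons_plane R n) (@lebesgue_plane R \x Cn_measure n)%E) => //.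
have := has_cintegral_tensor (hI ord0)
  (IHn (fun k => h (lift ord0 k)) _ (fun k => hI (lift ord0 k))).
congr has_cintegral; apply/funext => -[x t] /=.
rewrite big_ord_recl tnth0; congr (_ * _); apply: eq_bigr => k _.
by rewrite tnthS.
Qed.

End TupleProduct.

(** * The moment formula for the Gaussian measure on [C^n] *)

Section GaussianCn.
Variables (R : realType) (n : nat).
Local Notation C := R[i].
Local Notation Cn := 'rV[C]_n.
Implicit Types (h : Cn -> C) (a b c w z e : Cn) (I J : C).

Definition has_integral_dmu h I :=
  has_cintegral (lebesgue_Cn R n) (fun t => h (to_Cn t) * gauss_density (to_Cn t)) I.

Lemma has_integral_dmu_integrable h I : has_integral_dmu h I -> integrable_dmu h.
Proof. by case. Qed.

Lemma has_integral_dmu_integral h I : has_integral_dmu h I -> integral_dmu h = I.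
Proof. by case. Qed.

Lemma has_integral_dmu_ext h h' I :
  h =1 h' -> has_integral_dmu h I -> has_integral_dmu h' I.
Proof. by move=> /funext ->. Qed.

(** Used twice: for a polynomial as a sum of monomials, and for elements of the span of the
    kernels. *)
Lemma has_integral_dmu_sum (A : Type) (s : seq A) (x : A -> C)
    (h : A -> Cn -> C) (I : A -> C) :
  (forall i, has_integral_dmu (h i) (I i)) ->
  has_integral_dmu (fun w => \sum_(i <- s) x i * h i w) (\sum_(i <- s) x i * I i).
Proof.
move=> hI; rewrite /has_integral_dmu; under eq_fun do rewrite mulr_suml.
apply: has_cintegral_sum => i _; under eq_fun do rewrite -mulrA.
exact/has_cintegralZ/hI.
Qed.

(** The integrand, density included, is a product over the coordinates; each one-variable moment
    contributes a factor [pi], and together these cancel [pi^-n]. *)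
Lemma has_integral_dmu_monomial (m : 'I_n -> nat) b c :
  has_integral_dmu
    (fun w => (\prod_(k < n) w 0 k ^+ m k) * cexp (cdot w b + cdot c (conjv w)))
    ((\prod_(k < n) c 0 k ^+ m k) * cexp (cdot c b)).
Proof.
have pin : (pi ^- n)%:C * \prod_(k < n) pi%:C = 1 :> C.
  rewrite prodr_const card_ord -rmorphXn -rmorphM mulVf ?rmorph1//.
  by rewrite expf_neq0// gt_eqF// pi_gt0.
have valE : (pi ^- n)%:C * \prod_(k < n)
    (pi%:C * c 0 k ^+ m k * cexp (b 0 k * c 0 k)) =
    (\prod_(k < n) c 0 k ^+ m k) * cexp (cdot c b).
  rewrite 2!big_split /= 2!mulrA pin mul1r /cdot cexp_sum.
  by congr (_ * _); apply: eq_bigr => k _; rewrite mulrC.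
have funE t : (pi ^- n)%:C * \prod_(k < n)
    (to_C (tnth t k) ^+ m k * gauss_exp (b 0 k) (c 0 k) (tnth t k)) =
    (\prod_(k < n) to_Cn t 0 k ^+ m k) *
    cexp (cdot (to_Cn t) b + cdot c (conjv (to_Cn t))) * gauss_density (to_Cn t).
  have -> : \prod_(k < n) (to_C (tnth t k) ^+ m k *
      gauss_exp (b 0 k) (c 0 k) (tnth t k)) =
      (\prod_(k < n) to_Cn t 0 k ^+ m k) *
      (cexp (cdot (to_Cn t) b + cdot c (conjv (to_Cn t))) *
       cexp (- cdot (to_Cn t) (conjv (to_Cn t)))).
    rewrite big_split /=; congr (_ * _).
      by apply: eq_bigr => k _; rewrite mxE.
    rewrite -cexpD /gauss_exp -cexp_sum; congr cexp.
    rewrite /cdot -big_split -sumrB /=; apply: eq_bigr => k _.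
    by rewrite !mxE -/(to_C _) [_ * b 0 k]mulrC.
  by rewrite /gauss_density; ring.
rewrite /has_integral_dmu -valE -(funext funE); apply: has_cintegralZ.
apply: (has_cintegral_tuple (fun k => has_cintegral_moment (m k) (b 0 k) (c 0 k))).
Qed.

(** By linearity from the monomials. All integrals of the theorem are sums of this form: [b]
    collects the holomorphic exponents and [c] the antiholomorphic ones. *)
Lemma has_integral_dmu_poly (p : mpoly.mpoly n C) b c :
  has_integral_dmu (fun w => poly_fun p w * cexp (cdot w b + cdot c (conjv w)))
    (poly_fun p c * cexp (cdot c b)).
Proof.
rewrite /poly_fun mpoly.mevalE mulr_suml.
under eq_bigr do rewrite -mulrA.
have := has_integral_dmu_sum (mpoly.msupp p) (fun m => mpoly.mcoeff m p)
  (fun m : mpoly.multinom n => has_integral_dmu_monomial (mpoly.fun_of_multinom m) b c).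
apply: has_integral_dmu_ext => w.
by rewrite mpoly.mevalE mulr_suml; apply: eq_bigr => m _; rewrite mulrA.
Qed.

End GaussianCn.

(** * Bilinearity of the dot product and conjugate kernels, for the operator identity *)

Section CdotLemmas.
Variables (R : realType) (n : nat).
Implicit Types (v w z : 'rV[R[i]]_n).

Lemma cdotDl v w z : cdot (v + w) z = cdot v z + cdot w z.
Proof. by rewrite /cdot -big_split; apply: eq_bigr => k _; rewrite mxE mulrDl. Qed.

Lemma cdotDr v w z : cdot z (v + w) = cdot z v + cdot z w.
Proof. by rewrite /cdot -big_split; apply: eq_bigr => k _; rewrite mxE mulrDr. Qed.

Lemma fock_kernel_conj v w : (fock_kernel v w)^*%C = cexp (cdot v (conjv w)).
Proof.
rewrite /fock_kernel -cexpJ /cdot rmorph_sum; congr cexp; apply: eq_bigr => k _.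
by rewrite !mxE rmorphM /= conjcK mulrC.
Qed.

End CdotLemmas.

Theorem corollary6 (R : realType) (n : nat) (hn : (2 <= n)%N)
    (p : mpoly.mpoly n R[i])
    (p_nonconst : ~ exists c : R[i], p = mpoly.mpolyC n c)
    (p_last : forall z : 'rV[R[i]]_n, poly_fun p z = poly_fun p (zero_last z)) :
  let f := fock_kernel ((- ((2 * pi)%:C * 'i%C)) *: last_unit R n) in
  let g := fock_kernel (last_unit R n) in
  let pf := fun w => poly_fun p w * f w in
  let gbar := fun w => (g w)^*%C in
  let pfgbar := fun w => poly_fun p w * f w * (g w)^*%C in
  forall F : 'rV[R[i]]_n -> R[i], kernel_span F ->
    [/\ toeplitz_converges gbar F,
        toeplitz_converges pf (toeplitz gbar F),
        toeplitz_converges pfgbar F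
      & forall z, toeplitz pf (toeplitz gbar F) z = toeplitz pfgbar F z].
Proof.
move=> f g pf gbar pfgbar F [s Fs].
pose e := last_unit R n.
(* Thus [u] is [2 pi i e], and [f] is the exponential of [w . u]. *)
pose u := conjv (- ((2 * pi)%:C * 'i%C) *: e).
have fE w : f w = cexp (cdot w u) by [].
have gE w : (g w)^*%C = cexp (cdot e (conjv w)) by exact: fock_kernel_conj.
(* This is the value of [f] at [e], namely [exp (2 pi i)]; the last coordinate has index [n - 1]. *)
have eu : cexp (cdot e u) = 1.
  have lt_n : (n.-1 < n)%N by rewrite prednK// (leq_trans _ hn).
  have kn : (Ordinal lt_n).+1 = n by rewrite /= prednK// (leq_trans _ hn).
  rewrite -/(fock_kernel _ e) (fock_kernel_2pi_last _ kn) !mxE kn eqxx mulr1.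
  exact: cexp_2pi_i.
(* [z] and [z + e] agree once the last coordinate is erased. *)
have p_shift z : poly_fun p (z + e) = poly_fun p z.
  rewrite p_last [RHS]p_last; congr poly_fun; apply/rowP => k; rewrite !mxE.
  by case: eqP => // _; rewrite mulr0n addr0.
(* The moment formula summed over the kernels of [F]: polynomial [q], antiholomorphic vector [c],
   coefficients [x] and holomorphic vectors [b]. *)
pose J q c (x : R[i] * 'rV[R[i]]_n -> R[i]) (b : R[i] * 'rV[R[i]]_n -> 'rV[R[i]]_n) :=
  has_integral_dmu_sum s x (fun a => has_integral_dmu_poly q (b a) c).
(* The factor [gbar] adds [e] to the vector paired with [conj w]; the polynomial is the constant
   1. *)
have JF z : has_integral_dmu (fun w => gbar w * F w * cexp (cdot z (conjv w)))
    (\sum_(a <- s) a.1 * cexp (cdot (z + e) (conjv a.2))).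
  have := J (mpoly.mpolyC n 1) (z + e) fst (fun a => conjv a.2).
  rewrite /poly_fun mpoly.mevalC; under eq_bigr do rewrite mul1r.
  apply: has_integral_dmu_ext => w; rewrite /gbar gE Fs mulr_sumr mulr_suml.
  apply: eq_bigr => a _.
  by rewrite mpoly.mevalC mul1r cdotDl !cexpD /fock_kernel; ring.
have TF z : toeplitz gbar F z =
    \sum_(a <- s) a.1 * cexp (cdot (z + e) (conjv a.2)).
  exact: has_integral_dmu_integral (JF z).
(* [toeplitz gbar F] is again a combination of the same kernels, each coefficient being multiplied
   by [exp (e . conj a)], and [f] adds [u] to the holomorphic vectors. *)
have JT z : has_integral_dmu
    (fun w => pf w * toeplitz gbar F w * cexp (cdot z (conjv w)))
    (\sum_(a <- s) a.1 * cexp (cdot e (conjv a.2)) *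
       (poly_fun p z * cexp (cdot z (u + conjv a.2)))).
  have := J p z (fun a => a.1 * cexp (cdot e (conjv a.2))) (fun a => u + conjv a.2).
  apply: has_integral_dmu_ext => w; rewrite TF mulr_sumr mulr_suml.
  apply: eq_bigr => a _.
  by rewrite /pf fE cdotDl cdotDr !cexpD; ring.
(* Here both effects occur in one integral, so [p] and [f] are evaluated at [z + e] as well. *)
have JP z : has_integral_dmu
    (fun w => pfgbar w * F w * cexp (cdot z (conjv w)))
    (\sum_(a <- s) a.1 * (poly_fun p (z + e) * cexp (cdot (z + e) (u + conjv a.2)))).
  have := J p (z + e) fst (fun a => u + conjv a.2).
  apply: has_integral_dmu_ext => w; rewrite Fs mulr_sumr mulr_suml.
  apply: eq_bigr => a _.
  by rewrite /pfgbar fE gE /fock_kernel cdotDl cdotDr !cexpD; ring.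
split=> z.
- exact: has_integral_dmu_integrable (JF z).
- exact: has_integral_dmu_integrable (JT z).
- exact: has_integral_dmu_integrable (JP z).
rewrite /toeplitz (has_integral_dmu_integral (JT z)).
rewrite (has_integral_dmu_integral (JP z)); apply: eq_bigr => a _.
(* The shift by [e] leaves [p] unchanged and multiplies [f] by [exp (e . u) = 1]; the remaining
   factor [exp (e . conj a)] is on both sides. *)
by rewrite p_shift !cdotDl !cdotDr !cexpD eu; ring.
Qed.
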